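(* Let $\phi\in C^1(\mathbb{R}^d)$ be bounded from below, let $\tau_i>0$, and let $u_{i-1}\in\mathbb{R}^d$ satisfy $\mathrm{D}\phi(u_{i-1})\neq 0$. Then there exists $u_i\in\mathbb{R}^d\setminus\{u_{i-1}\}$ such that $$\frac{u_i-u_{i-1}}{\tau_i}+\mathrm{D}\phi(u_i)+\big(\phi(u_i)-\phi(u_{i-1})-(\mathrm{D}\phi(u_i),u_i-u_{i-1})\big)\frac{u_i-u_{i-1}}{\|u_i-u_{i-1}\|^2}=0.$$
   Context: $(\cdot,\cdot)$ and $\|\cdot\|$ denote the Euclidean scalar product and norm on $\mathbb{R}^d$, and $\mathrm{D}\phi$ is the gradient of $\phi$. The displayed equation is one step, with time step $\tau_i$, of the Gonzalez scheme for the gradient flow $u'+\mathrm{D}\phi(u)=0$. *)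

(* Defs.v *)
From HB Require Import structures.
From mathcomp Require Import all_boot all_order all_algebra.
From mathcomp Require Import all_classical all_reals all_analysis.

Set Implicit Arguments.
Unset Strict Implicit.
Unset Printing Implicit Defensive.

Import Order.TTheory GRing.Theory Num.Theory.
Import numFieldNormedType.Exports.

Local Open Scope ring_scope.
Local Open Scope classical_set_scope.

Definition dotv (R : realType) (d : nat) (u v : 'rV[R]_d) : R :=
  \sum_(i < d) u 0 i * v 0 i.

(* The library norm on 'rV[R]_d is the sup norm, hence this definition.
   The topology is the same. *)
Definition enorm (R : realType) (d : nat) (u : 'rV[R]_d) : R :=
  Num.sqrt (dotv u u).

Definition grad (R : realType) (d : nat) (phi : 'rV[R]_d -> R) (x : 'rV[R]_d)
    : 'rV[R]_d :=
  \row_(i < d) 'D_(delta_mx 0 i) phi x.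

Definition C1 (R : realType) (d : nat) (phi : 'rV[R]_d -> R) : Prop :=
  (forall x, differentiable phi x) /\ continuous (grad phi).

(* Main.v *)
(** Among the points u with |u - u0|^2 / tau + phi u - phi u0 <= 0, a compact
    set, take one farthest from u0; it differs from u0 because a short step
    along - grad phi u0 stays in the set. If grad phi u had a nonzero component
    w orthogonal to v = u - u0, a short step along - w would remain in the set
    and increase the distance, so grad phi u is a multiple of v. If the
    inequality at u were strict, a short step along v would do the same, so it
    is an equality. These two facts are the parts of the Gonzalez equation
    orthogonal to v and along v. *)
Require Import Defs.
From HB Require Import structures.
From mathcomp Require Import all_boot all_order all_algebra.
From mathcomp Require Import all_classical all_reals all_analysis.
From mathcomp Require Import ring lra.

Import Order.TTheory GRing.Theory Num.Theory.
Import numFieldNormedType.Exports.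

Local Open Scope ring_scope.
Local Open Scope classical_set_scope.

Section DotProduct.
Set Implicit Arguments.
Unset Strict Implicit.
Variables (R : realType) (d : nat).
Implicit Types (u v w : 'rV[R]_d) (a : R).

Lemma dotvC u v : dotv u v = dotv v u.
Proof. by apply: eq_bigr => i _; rewrite mulrC. Qed.

Lemma dotvDl u v w : dotv (u + v) w = dotv u w + dotv v w.
Proof. by rewrite -big_split; apply: eq_bigr => i _; rewrite mxE mulrDl. Qed.

Lemma dotvZl a u v : dotv (a *: u) v = a * dotv u v.
Proof. by rewrite mulr_sumr; apply: eq_bigr => i _; rewrite mxE mulrA. Qed.

Lemma dotvDr u v w : dotv w (u + v) = dotv w u + dotv w v.
Proof. by rewrite dotvC dotvDl !(dotvC w). Qed.

Lemma dotvZr a u v : dotv u (a *: v) = a * dotv u v.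
Proof. by rewrite dotvC dotvZl dotvC. Qed.

Lemma dotv_sqrDZ a u v : dotv (u + a *: v) (u + a *: v) =
  dotv u u + 2 * a * dotv u v + a ^+ 2 * dotv v v.
Proof. by rewrite dotvDl !dotvDr !dotvZr !dotvZl (dotvC v u); ring. Qed.

Lemma dotv0 u : dotv u 0 = 0.
Proof. by apply: big1 => i _; rewrite mxE mulr0. Qed.

Lemma dotvN u v : dotv u (- v) = - dotv u v.
Proof. by rewrite -scaleN1r dotvZr mulN1r. Qed.

Lemma dotv_ge0 u : 0 <= dotv u u.
Proof. by apply: sumr_ge0 => i _; rewrite -expr2 sqr_ge0. Qed.

Lemma sqr_coord_le_dotv u i : u 0 i ^+ 2 <= dotv u u.
Proof.
rewrite /dotv (bigD1 i)//= -expr2 lerDl.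
by apply: sumr_ge0 => j _; rewrite -expr2 sqr_ge0.
Qed.

Lemma dotv_gt0 u : u != 0 -> 0 < dotv u u.
Proof.
move=> u0; rewrite lt_neqAle dotv_ge0 andbT eq_sym; apply: contra u0 => /eqP uu.
apply/eqP/rowP => i; rewrite mxE; apply/eqP.
by rewrite -sqrf_eq0 eq_le sqr_ge0 andbT -uu sqr_coord_le_dotv.
Qed.

Lemma enorm_sqr u : enorm u ^+ 2 = dotv u u.
Proof. by rewrite sqr_sqrtr// dotv_ge0. Qed.

Lemma continuous_dotv_sub u0 : continuous (fun u => dotv (u - u0) (u - u0)).
Proof.
have coordB i : continuous (fun x : 'rV[R]_d => x 0 i - u0 0 i).
  by move=> u; apply: continuousB;
    [exact: coord_continuous|exact: cst_continuous].
have -> : (fun u => dotv (u - u0) (u - u0)) =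
    \sum_(i < d) (fun u : 'rV[R]_d => (u 0 i - u0 0 i) * (u 0 i - u0 0 i)).
  by apply/funext => u; rewrite fct_sumE; apply: eq_bigr => i _; rewrite !mxE.
apply: (big_ind (fun f : 'rV[R]_d -> R => continuous f)) => [|f g cf cg|i _].
- exact: cst_continuous.
- by move=> u; apply: continuousD; [exact: cf|exact: cg].
- move=> u; exact: (continuousM (coordB i u) (coordB i u)).
Qed.

Lemma derive_dotv (phi : 'rV[R]_d -> R) u v : differentiable phi u ->
  'D_v phi u = dotv (grad phi u) v.
Proof.
move=> phiu; rewrite deriveE// [in LHS](row_sum_delta v) linear_sum.
by apply: eq_bigr => i _; rewrite linearZ mxE deriveE//= mulrC.
Qed.

End DotProduct.

Section Descent.
Set Implicit Arguments.
Unset Strict Implicit.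
Variables (R : realType) (d : nat).
Implicit Types (u v w : 'rV[R]_d) (phi : 'rV[R]_d -> R).

(** Divided by [t], the quadratic term tends to 0 and the increment of [phi] tends to
    ['D_w phi u < 0]. The term in [c] leaves room for the growth of the squared distance under an
    orthogonal step. *)
Lemma descent_step phi u w (c : R) : differentiable phi u ->
  dotv (grad phi u) w < 0 ->
  exists2 t : R, 0 < t & c * t ^+ 2 + phi (u + t *: w) < phi u.
Proof.
move=> phiu; rewrite -derive_dotv// => Dlt0.
have /cvg_dnbhs_at_right cvgq : h^-1 *: ((phi \o shift u) (h *: w) - phi u)
    @[h --> 0^'] --> 'D_w phi u by exact: (diff_derivable phiu).
have cvgch : c * h @[h --> (0:R)^'+] --> c * 0.
  by apply: cvg_at_right_filter; apply: cvgMr; exact: cvg_id.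
have := cvgr_lt _ (cvgD cvgch cvgq) 0; rewrite mulr0 add0r => /(_ _ _ Dlt0).
move=> /(filterI (nbhs_right_gt 0)) /filter_ex [t [/= t0]].
rewrite -(pmulr_rlt0 _ t0) mulrDr /GRing.scale/= mulVKf ?gt_eqF// => lt0.
by exists t => //; rewrite [u + _]addrC expr2 (mulrC c) -mulrA (mulrC t c); lra.
Qed.

End Descent.

Theorem theorem3p1 (R : realType) (d : nat) (phi : 'rV[R]_d -> R)
    (tau : R) (u0 : 'rV[R]_d)
    (phiC1 : C1 phi)
    (phi_lb : has_lbound (range phi))
    (tau_gt0 : 0 < tau)
    (grad_neq0 : grad phi u0 <> 0) :
  exists u : 'rV[R]_d,
    u <> u0 /\
    tau^-1 *: (u - u0) + grad phi u
      + (phi u - phi u0 - dotv (grad phi u) (u - u0))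
          *: ((enorm (u - u0) ^+ 2)^-1 *: (u - u0)) = 0.
Proof.
have [dphi _] := phiC1; have [M Mlb] := phi_lb.
(* [F u] is the scalar product of the left side of the Gonzalez equation with [u - u0]: the two
   gradient terms cancel. *)
pose F (u : 'rV[R]_d) := tau^-1 * dotv (u - u0) (u - u0) + phi u - phi u0.
pose K := [set u | F u <= 0].
have cF : continuous F.
  move=> u.
  have cphi := differentiable_continuous (dphi u).
  have cdist := continuousM (@cst_continuous _ _ tau^-1 u)
    (@continuous_dotv_sub _ _ u0 u).
  exact: (continuousB (continuousD cdist cphi) (@cst_continuous _ _ (phi u0) u)).
have Kcompact : compact K.
  (* On [K] every coordinate [x] of [u - u0] satisfies [x ^+ 2 <= c] with [c = tau * (phi u0 - M)].
     Since [2 * |x| <= x ^+ 2 + 1], this gives [|x| <= c + 1] without a square root. *)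
  pose B := tau * (phi u0 - M) + 1.
  apply: (@subclosed_compact _ K
      [set v : 'rV[R]_d | forall i, `[u0 0 i - B, u0 0 i + B] (v 0 i)]).
  - by apply: (preimage_closed _ (@closed_le _ 0)) => u _; exact: cF.
  - exact: (@rV_compact _ _ (fun i => `[u0 0 i - B, u0 0 i + B]%classic)
      (fun i => @segment_compact _ _ _)).
  move=> u /= Ku i; rewrite in_itv/=.
  have Mu : M <= phi u by apply: Mlb; exists u.
  have := sqr_coord_le_dotv (u - u0) i; rewrite !mxE.
  have : dotv (u - u0) (u - u0) <= tau * (phi u0 - M).
    by rewrite -ler_pdivrMl//; move: Ku; rewrite /K /F /=; lra.
  have := sqr_ge0 (u 0 i - u0 0 i - 1); have := sqr_ge0 (u 0 i - u0 0 i + 1).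
  have := sqr_ge0 (u 0 i - u0 0 i).
  rewrite /B; move: (tau * _) (dotv _ _) => c q *.
  by apply/andP; split; lra.
(* Orthogonality removes the linear term of the squared distance, so the first term of [F] grows by
   exactly [tau^-1 * t ^+ 2 * dotv w w]. *)
have Kstep u w : K u -> dotv (u - u0) w = 0 -> dotv (grad phi u) w < 0 ->
    exists2 t : R, 0 < t & K (u + t *: w).
  move=> Ku vw /(descent_step (tau^-1 * dotv w w) (dphi u)) [t t0 Ht].
  exists t => //; apply: le_trans Ku; rewrite /F.
  rewrite [u + _ - u0]addrAC dotv_sqrDZ vw.
  by move: Ht; lra.
have u0K : K u0 by rewrite /K /= /F subrr dotv0; lra.
have [u] : exists2 u, u \in K &
    forall v, v \in K -> dotv (v - u0) (v - u0) <= dotv (u - u0) (u - u0).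
  apply: EVT_max_rV => //; first by exists u0.
  by apply: continuous_subspaceT; exact: continuous_dotv_sub.
rewrite inE => Ku umax.
pose v := u - u0.
have v_neq0 : v != 0.
  apply/eqP => v0.
  have gg_gt0 := dotv_gt0 (introN eqP grad_neq0).
  (* At [u0] the orthogonality condition is trivial, so every descent direction is allowed. *)
  have [|||t t0 Kt] := Kstep u0 (- grad phi u0) => //.
  - by rewrite subrr dotvC dotv0.
  - by rewrite dotvN oppr_lt0.
  have := umax _ (mem_set Kt); rewrite [u0 + _ - u0]addrAC subrr -/v v0.
  rewrite dotv_sqrDZ !dotv0 dotvC dotv0 dotvN (dotvC (- _)) dotvN.
  have : 0 < t ^+ 2 * dotv (grad phi u0) (grad phi u0).
    by rewrite mulr_gt0 ?exprn_gt0.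
  by lra.
have vv_gt0 := dotv_gt0 v_neq0.
(* [a *: v] is the orthogonal projection of the gradient onto the line of [v]; the residual [w]
   below has to vanish. *)
pose a := dotv (grad phi u) v / dotv v v.
have gradE : grad phi u = a *: v.
  apply/eqP; rewrite -subr_eq0; apply/negPn/negP => w_neq0.
  set w := _ - _ in w_neq0; have ww := dotv_gt0 w_neq0.
  have vw : dotv v w = 0.
    rewrite /w -scaleNr dotvDr dotvZr (dotvC v (grad _ _)) /a.
    by rewrite mulNr mulfVK ?gt_eqF// subrr.
  have gw : dotv (grad phi u) w = dotv w w.
    by rewrite -(subrK (a *: v) (grad phi u)) -/w dotvDl dotvZl vw mulr0 addr0.
  have [|||t t0 Kt] := Kstep u (- w) => //.
  - by rewrite dotvN vw oppr0.
  - by rewrite dotvN gw oppr_lt0.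
  have := umax _ (mem_set Kt); rewrite [u + _ - u0]addrAC -/v.
  rewrite dotv_sqrDZ !dotvN (dotvC (- _)) dotvN vw.
  have : 0 < t ^+ 2 * dotv w w by rewrite mulr_gt0 ?exprn_gt0.
  by lra.
have Fu0 : F u = 0.
  apply/eqP; rewrite eq_le Ku/= leNgt; apply/negP => Fu_lt0.
  have cvgu : u + t *: v @[t --> (0:R)^'+] --> u + 0 *: v.
    apply: cvg_at_right_filter; apply: cvgD; first exact: cvg_cst.
    by apply: cvgZr_tmp; exact: cvg_id.
  (* By continuity [F] stays negative near [u]. Moving outward along [v] multiplies the distance by
     [1 + t], against maximality. *)
  have : \forall t \near (0:R)^'+, K (u + t *: v).
    move: cvgu; rewrite scale0r addr0 => cvgu.
    have := cvg_comp _ _ cvgu (cF u) => /cvgr_le; exact.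
  move=> /(filterI (nbhs_right_gt 0)) /filter_ex [t [/= t0 Kt]].
  have := umax _ (mem_set Kt); rewrite [u + _ - u0]addrAC -/v dotv_sqrDZ.
  have := mulr_gt0 t0 vv_gt0.
  have : 0 < t ^+ 2 * dotv v v by rewrite mulr_gt0 ?exprn_gt0.
  by lra.
exists u; split; first by move=> uu0; rewrite /v uu0 subrr eqxx in v_neq0.
(* Every term is now a multiple of [v]. In the total coefficient [a] cancels, leaving
   [F u / dotv v v], which is 0. *)
rewrite enorm_sqr -/v gradE dotvZl scalerA -!scalerDl.
rewrite [X in X *: _](_ : _ = 0) ?scale0r//.
rewrite mulrBl mulfK ?gt_eqF//.
suff -> : phi u - phi u0 = - (tau^-1 * dotv v v).
  by rewrite mulNr mulfK ?gt_eqF//; ring.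
by move: Fu0; rewrite /F -/v; lra.
Qed.
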